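(* Let $p$ be an odd prime. For each $n\in\mathbb{N}$, the groups $\Gamma^{\mathrm{Hol}}_{n,1},\Gamma^{\mathrm{Hol}}_{n,2},\ldots$ together with the surjections $\pi_{n,k}:\Gamma^{\mathrm{Hol}}_{n,k}\to\Gamma^{\mathrm{Hol}}_{n,k-1}$ form an infinite uniform tower.
   Context: For a group $K$, $\mathrm{Hol}(K)$ is the group of pairs $(f,x)$, $f\in\mathrm{Aut}(K)$, $x\in K$, with multiplication $(f,x)(g,y)=(fg,g^{-1}(x)y)$. $\bigoplus_n\mathbb{Z}_m$ is the direct sum of $n$ copies of the cyclic group of order $m$. $\Gamma^{\mathrm{Hol}}_{n,k}$ is the kernel of the reduction map $\mathrm{Hol}(\bigoplus_n\mathbb{Z}_{p^{k+1}})\to\mathrm{Hol}(\bigoplus_n\mathbb{Z}_p)$, and $\pi_{n,k}$ is the surjection induced by reduction $\mathrm{Hol}(\bigoplus_n\mathbb{Z}_{p^{k+1}})\to\mathrm{Hol}(\bigoplus_n\mathbb{Z}_{p^k})$. For a finite $p$-group $G$, $\Omega_1(G)$ is the subgroup generated by all $g\in G$ with $g^p=1$; $G$ is $p$-central if $\Omega_1(G)$ is central in $G$. A tower of groups is a sequence of $p$-central groups $G_1,G_2,\ldots$ with surjective homomorphisms $\pi_i:G_i\to G_{i-1}$ with $\ker(\pi_i)=\Omega_1(G_i)$. For such a tower, the central extension $1\to\Omega_1(G_i)\to G_i\to G_{i-1}\to1$ pulls back to $1\to\Omega_1(G_i)\to E_i\to\Omega_1(G_{i-1})\to1$, and the $p$-power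 map $\phi:\Omega_1(G_{i-1})\to\Omega_1(G_i)$ is $\phi(x)=\bar{x}^p$, where $\bar{x}\in E_i$ is a preimage of $x$. The tower is uniform if all its $p$-power maps are isomorphisms. *)

(* Defs.v *)
From HB Require Import structures.
From mathcomp Require Import all_boot all_order all_fingroup all_algebra all_solvable.

Set Implicit Arguments.
Unset Strict Implicit.
Unset Printing Implicit Defensive.

Import GroupScope.

(* Permutations compose from left to right in this library: (s * t) x = t (s x).
   The composite f o g of two automorphisms is therefore written g * f. *)

Section Holomorph.

Variable gT : finGroupType.

Inductive hol : predArgType :=
  Hol (fx : {perm gT} * gT) of fx.1 \in Aut [set: gT].

Coercion pair_of_hol (u : hol) := let: Hol fx _ := u in fx.

HB.instance Definition _ := [isSub for pair_of_hol].
#[hnf] HB.instance Definition _ := [Finite of hol by <:].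

Lemma hol_Aut (u : hol) : u.1 \in Aut [set: gT].
Proof. by case: u. Qed.

Definition hol_one : hol := @Hol (1, 1) (group1 _).

Lemma hol_mul_proof (u v : hol) :
  (v.1 * u.1, v.1^-1 u.2 * v.2).1 \in Aut [set: gT].
Proof. by rewrite groupM ?hol_Aut. Qed.

Definition hol_mul (u v : hol) : hol := Hol (hol_mul_proof u v).

Lemma hol_inv_proof (u : hol) : (u.1^-1, u.1 u.2^-1).1 \in Aut [set: gT].
Proof. by rewrite groupV hol_Aut. Qed.

Definition hol_inv (u : hol) : hol := Hol (hol_inv_proof u).

Lemma Aut_setT_morph (f : {perm gT}) :
  f \in Aut [set: gT] -> {morph f : x y / x * y}.
Proof. by move=> Af x y; apply: (morphicP (Aut_morphic Af)); rewrite inE. Qed.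

Lemma hol_mulA : associative hol_mul.
Proof.
move=> u v w; apply: val_inj => /=; congr (_, _); first by rewrite mulgA.
have Aw: w.1^-1 \in Aut [set: gT] by rewrite groupV hol_Aut.
by rewrite (Aut_setT_morph Aw) invMg permM mulgA.
Qed.

Lemma hol_mul1 : left_id hol_one hol_mul.
Proof.
move=> u; apply: val_inj => /=; rewrite mulg1.
have Au: u.1^-1 \in Aut [set: gT] by rewrite groupV hol_Aut.
have ->: u.1^-1 1 = 1.
  by apply: (mulgI (u.1^-1 1)); rewrite -(Aut_setT_morph Au) !mulg1.
by rewrite mul1g; case: (pair_of_hol u).
Qed.

Lemma hol_mulV : left_inverse hol_one hol_inv hol_mul.
Proof.
move=> u; apply: val_inj => /=; congr (_, _); first by rewrite mulgV.
by rewrite permK mulVg.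
Qed.

HB.instance Definition _ := Finite_isGroup.Build hol hol_mulA hol_mul1 hol_mulV.

End Holomorph.

Section InducedMap.

Variables (gT rT : finGroupType) (r : gT -> rT).

(* The automorphism f' of rT such that f' o r = r o f. It is unique when r is
   onto, and it exists when moreover f preserves the kernel of r; the value 1
   is a junk value for the other cases. *)
Definition induced_aut (f : {perm gT}) : {perm rT} :=
  odflt 1 [pick f' in Aut [set: rT] | [forall x, f' (r x) == r (f x)]].

Lemma induced_aut_proof (u : hol gT) :
  (induced_aut u.1, r u.2).1 \in Aut [set: rT].
Proof. by rewrite /= /induced_aut; case: pickP => [f' /andP[]|_] //=. Qed.

Definition hol_map (u : hol gT) : hol rT := Hol (induced_aut_proof u).

Hypothesis rM : {morph r : x y / x * y}.
Hypothesis r_surj : forall y, exists x, r x = y.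
Hypothesis r_char : forall f x, f \in Aut [set: gT] -> r x = 1 -> r (f x) = 1.

Lemma induced_autE f x :
  f \in Aut [set: gT] -> induced_aut f (r x) = r (f x).
Proof.
move=> Af; rewrite /induced_aut; case: pickP => [f' /andP[_ /forallP/(_ x)/eqP]|] //=.
have r1: r 1 = 1 by apply: (mulgI (r 1)); rewrite -rM !mulg1.
have rV a: r a^-1 = (r a)^-1.
  by apply: (mulgI (r a)); rewrite -rM !mulgV.
have rE g a b: g \in Aut [set: gT] -> r a = r b -> r (g a) = r (g b).
  move=> Ag eq_ab; apply/eqP; rewrite eq_mulgV1 -rV -rM.
  have Mg := Aut_setT_morph Ag.
  have g1: g 1 = 1 by apply: (mulgI (g 1)); rewrite -Mg !mulg1.
  have ->: (g b)^-1 = g b^-1 by apply: (mulgI (g b)); rewrite -Mg !mulgV.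
  by rewrite -Mg r_char // rM rV eq_ab mulgV.
have s_ex y: exists x, r x == y by case: (r_surj y) => z <-; exists z.
pose s y := xchoose (s_ex y); have sK y: r (s y) = y by apply/eqP/(xchooseP (s_ex y)).
pose h y := r (f (s y)).
have hE a: h (r a) = r (f a) by apply: rE; rewrite ?sK.
have h_inj: injective h.
  move=> y z; rewrite -(sK y) -(sK z) !hE => /(rE f^-1).
  by rewrite groupV !permK; apply.
move/(_ (perm h_inj))/negP; case; apply/andP; split; last first.
  by apply/forallP=> a; rewrite permE hE.
rewrite inE; apply/andP; split; first by apply/subsetP=> y; rewrite inE.
apply/morphicP=> y z _ _; rewrite -(sK y) -(sK z) -rM !permE !hE.
by rewrite (Aut_setT_morph Af) rM.
Qed.

Lemma hol_map_morph : {in [set: hol gT] &, {morph hol_map : u v / u * v}}.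
Proof.
move=> u v _ _; apply: val_inj; congr (_, _) => /=.
  apply/permP=> y; case: (r_surj y) => x <-.
  by rewrite permM !induced_autE ?groupM ?hol_Aut // permM.
rewrite rM; congr (_ * _); apply: (@perm_inj _ (induced_aut v.1)).
by rewrite permKV induced_autE ?hol_Aut // permKV.
Qed.

Definition hol_morphism : {morphism [set: hol gT] >-> hol rT} :=
  Morphism hol_map_morph.

End InducedMap.

Section PowerMap.

Variables (p : nat) (gT rT : finGroupType) (G : {group gT}) (H : {group rT}).

(* 'Ohm_1(G) is generated by the x in G with x ^+ pdiv #[x] = 1. This is the
   condition x ^+ p = 1 when G is a p-group (lemma OhmE). *)
Definition p_central : bool := p.-group G && ('Ohm_1(G) \subset 'Z(G)).

Variable pi : {morphism G >-> rT}.

(* The pullback of G -> H along the inclusion of 'Ohm_1(H) in H. *)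
Definition Ohm_pullback : {set gT} := pi @*^-1 'Ohm_1(H).

Definition ppower_map (x : rT) : gT :=
  repr [set y in Ohm_pullback | pi y == x] ^+ p.

(* The chosen preimage does not matter. *)
Lemma ppower_mapE y : p_central -> 'ker pi = 'Ohm_1(G) ->
  y \in Ohm_pullback -> ppower_map (pi y) = y ^+ p.
Proof.
case/andP=> pG sOZ kerE Ey; rewrite /ppower_map.
set A := [set z in _ | _]; set z := repr A.
have: z \in A by apply: (@mem_repr _ A y); rewrite inE Ey eqxx.
rewrite inE => /andP[Ez /eqP eq_zy].
have [Gy _] := morphpreP Ey; have [Gz _] := morphpreP Ez.
have: y^-1 * z \in 'Ohm_1(G).
  by rewrite -kerE; apply/kerP; rewrite ?groupM ?groupV // morphM ?groupV // morphV // eq_zy mulVg.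
set t := y^-1 * z => Ot; have ->: z = y * t by rewrite mulKVg.
have abO: abelian 'Ohm_1(G).
  by rewrite /abelian (subset_trans sOZ) // subIset // orbC centS ?Ohm_sub.
have /centerP[_ Zt] := subsetP sOZ _ Ot.
rewrite expgMn; last by apply/esym/Zt.
move: Ot; rewrite (OhmEabelian pG abO) => /LdivP[_].
by rewrite expn1 => ->; rewrite mulg1.
Qed.

End PowerMap.

Section Tower.

Variables (p : nat) (gT : nat -> finGroupType) (G : forall i, {group gT i}).
Variable pi : forall i, {morphism G i.+1 >-> gT i}.

(* G 0, G 1, ... are the first, second, ... groups of the sequence. *)
Definition tower : Prop :=
  (forall i, p_central p (G i)) /\
  (forall i, pi i @* G i.+1 = G i /\ 'ker (pi i) = 'Ohm_1(G i.+1)).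

Definition uniform_tower : Prop :=
  tower /\
  forall i, misom 'Ohm_1(G i) 'Ohm_1(G i.+1) (ppower_map p (G i) (pi i)).

End Tower.

Arguments tower p {gT} G pi.
Arguments uniform_tower p {gT} G pi.

Section CongruenceHolomorph.

Variables p n : nat.

(* Written (Z/p^(k+1))^n below. 'Z_m is Z/m only for m > 1, which the exponent
   k.+1 guarantees when p is prime. *)
Definition Zpk (k : nat) : finGroupType := 'rV['Z_(p ^ k.+1)]_n.

Definition Zpk_red (k j : nat) (x : Zpk k) : Zpk j :=
  map_mx (fun a : 'Z_(p ^ k.+1) => (a%:R)%R : 'Z_(p ^ j.+1)) x.

Lemma Zp_trunc_dvd j k : j <= k ->
  (Zp_trunc (p ^ j.+1)).+2 %| (Zp_trunc (p ^ k.+1)).+2.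
Proof.
move=> le_jk; case: (leqP p 1) => [|p_gt1].
  by case: p => [|[|//]] _; rewrite ?exp0n ?exp1n.
have pX_gt1 m: 1 < p ^ m.+1 by rewrite -(exp1n m.+1) ltn_exp2r.
by rewrite !Zp_cast ?dvdn_exp2l.
Qed.

Section Reduction.

Variables (k j : nat) (le_jk : j <= k).

Lemma Zpk_redM : {morph @Zpk_red k j : x y / x * y}.
Proof.
move=> x y; apply/matrixP=> a b; rewrite !mxE -GRing.natrD !Zp_nat.
by apply: val_inj; rewrite /= modn_dvdm ?Zp_trunc_dvd.
Qed.

Lemma Zpk_red_surj y : exists x, @Zpk_red k j x = y.
Proof.
exists (map_mx (fun a : 'Z_(p ^ j.+1) => (a%:R)%R : 'Z_(p ^ k.+1)) y).
apply/matrixP=> a b; rewrite !mxE !Zp_nat; apply: val_inj => /=.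
by rewrite modn_dvdm ?Zp_trunc_dvd ?modn_small.
Qed.

Lemma Zpk_red_char f x :
  f \in Aut [set: Zpk k] -> @Zpk_red k j x = 1 -> @Zpk_red k j (f x) = 1.
Proof.
move=> Af; set d := (Zp_trunc (p ^ j.+1)).+2 => rx1.
have fM := Aut_setT_morph Af.
have f1: f 1 = 1 by apply: (mulgI (f 1)); rewrite -fM !mulg1.
have fX z m : f (z ^+ m) = f z ^+ m.
  by elim: m => // m IHm; rewrite !expgS fM IHm.
pose z : Zpk k := map_mx (fun a : 'Z_(p ^ k.+1) => (inZp (a %/ d) : 'Z_(p ^ k.+1))) x.
have expE (i : nat) (u : Zpk i) m a b :
    val ((u ^+ m) a b) = val (u a b) * m %% (Zp_trunc (p ^ i.+1)).+2.
  elim: m => [|m IHm]; first by rewrite muln0 mxE.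
  by rewrite expgS mxE /= IHm modnDmr mulnS.
have ->: x = z ^+ d.
  apply/matrixP=> a b; apply: val_inj; rewrite expE mxE /= modnMml.
  have /eqP := congr1 (fun u : 'rV_n => val (u a b)) rx1.
  by rewrite !mxE Zp_nat /= => xd; rewrite divnK ?modn_small.
rewrite fX; apply/matrixP=> a b; apply: val_inj.
rewrite mxE Zp_nat expE [RHS](_ : _ = 0); last by rewrite mxE.
by rewrite /= modn_dvdm ?Zp_trunc_dvd // modnMl.
Qed.

(* The reduction map Hol((Z/p^(k+1))^n) -> Hol((Z/p^(j+1))^n). *)
Definition hol_red : {morphism [set: hol (Zpk k)] >-> hol (Zpk j)} :=
  hol_morphism Zpk_redM Zpk_red_surj Zpk_red_char.

End Reduction.

Definition GammaHol (k : nat) : {group hol (Zpk k)} :=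
  'ker (hol_red (leq0n k)).

(* The map from the (k+1)-th to the k-th congruence subgroup. *)
Definition piHol (k : nat) : {morphism GammaHol k.+1 >-> hol (Zpk k)} :=
  [morphism of restrm (subsetT (GammaHol k.+1)) (hol_red (leqnSn k))].

End CongruenceHolomorph.

(* Main.v *)
Require Import Defs.
From mathcomp Require Import all_boot all_order all_fingroup all_algebra all_solvable.
From mathcomp Require Import zify.

Set Implicit Arguments.
Unset Strict Implicit.
Unset Printing Implicit Defensive.

Import GRing.Theory.
Local Open Scope ring_scope.

(* A pair (f, x) of the holomorph of K = (Z/p^(k+1))^n is the affine bijection
   z |-> f (z + x) of K, hence a matrix of size n + 1 acting on the row vectors
   (1, z). The congruence subgroup consists of the affine matrices 1 + p B. For
   p odd and a > 0, expanding the p-th power gives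
     (1 + p^a B)^p = 1 + p^(a+1) (B + p C),
   so an element 1 + p B has p-th power 1 exactly when it is 1 modulo p^k; these
   elements are central because p * p^k = 0, and they are the kernel of the
   reduction to level k. The p-power map sends 1 + p^k B to 1 + p^(k+1) B. *)

(** * Binomial expansion of p-th powers near 1 *)

Section OnePlusMultiple.

Variables (p : nat) (p_pr : prime p) (p_odd : odd p) (S : pzRingType).
Implicit Types B C : S.

(** For i < p the binomial coefficient supplies one factor p and a i >= a + 1 the others. For i = p
    only p^(a p) is available, and a p >= a + 2 because p >= 3. *)
Lemma dvdn_bin_expn a i : (0 < a)%N -> (1 < i <= p)%N ->
  (p ^ a.+2 %| 'C(p, i) * p ^ (a * i))%N.
Proof.
move=> a_gt0 /andP[i_gt1]; rewrite leq_eqVlt => /orP[/eqP-> | i_lt].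
  have p_gt2 : (2 < p)%N by rewrite odd_prime_gt2.
  by rewrite dvdn_mull // dvdn_exp2l //; nia.
rewrite expnS dvdn_mul ?prime_dvd_bin ?i_lt 1?ltnW //.
by rewrite dvdn_exp2l //; nia.
Qed.

Lemma expr_prime_1D a B : (0 < a)%N ->
  exists C, (1 + B *+ p ^ a) ^+ p = 1 + (B + C *+ p) *+ p ^ a.+1.
Proof.
(* [q i] is the coefficient of the i-th binomial term with p^(a+2) divided out; the term i = 1 is B
   p^(a+1). *)
move=> a_gt0; pose q i := ('C(p, i) * p ^ (a * i) %/ p ^ a.+2)%N.
exists (\sum_(2 <= i < p.+1) B ^+ i *+ q i).
rewrite addrC exprD1n -(big_mkord predT (fun i => (B *+ p ^ a) ^+ i *+ 'C(p, i))).
rewrite big_ltn // big_ltn ?ltnS ?prime_gt0 // bin0 bin1 expr0 expr1 mulr1n.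
rewrite mulrnDl -!mulrnA -expnS -expnSr -sumrMnl; congr (_ + (_ + _)).
apply: eq_big_nat => i i_itv.
by rewrite -mulrnA divnK ?dvdn_bin_expn // exprMn_n -mulrnA -expnM mulnC.
Qed.

Lemma expr_prime_iter_1D j B :
  exists C, (1 + B *+ p) ^+ (p ^ j) = 1 + C *+ p ^ j.+1.
Proof.
elim: j => [|j [C eqC]]; first by exists B; rewrite expr1 expn1.
have [D eqD] := expr_prime_1D C (ltn0Sn j).
by exists (C + D *+ p); rewrite expnSr exprM eqC eqD.
Qed.

End OnePlusMultiple.

(** * Divisibility and reduction of matrices modulo prime powers *)

Section PrimePowerMatrices.

Variables (p : nat) (p_pr : prime p).

Let pX_gt1 k : (1 < p ^ k.+1)%N.
Proof. by rewrite -(exp1n k.+1) ltn_exp2r ?prime_gt1. Qed.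

Let valZ_lt k (a : 'Z_(p ^ k.+1)) : (a < p ^ k.+1)%N.
Proof. by have := ltn_ord a; rewrite [X in (_ < X)%N](Zp_cast (pX_gt1 k)). Qed.

Let valZ_muln k (a : 'Z_(p ^ k.+1)) q : val (a *+ q) = (a * q %% p ^ k.+1)%N.
Proof. by rewrite Zp_mulrn /=; congr (_ %% _)%N; apply: Zp_cast. Qed.

Let valZ_add k (a b : 'Z_(p ^ k.+1)) : val (a + b) = ((a + b)%N %% p ^ k.+1)%N.
Proof. by rewrite /=; congr (_ %% _)%N; apply: Zp_cast. Qed.

Let valZ_opp k (a : 'Z_(p ^ k.+1)) : val (- a) = ((p ^ k.+1 - a)%N %% p ^ k.+1)%N.
Proof. by rewrite /=; congr ((_ - _) %% _)%N; apply: Zp_cast. Qed.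

Let val_inZp k a : val (inZp a : 'Z_(p ^ k.+1)) = (a %% p ^ k.+1)%N.
Proof. by rewrite /=; congr (_ %% _)%N; apply: Zp_cast. Qed.

Lemma mxZ_pX_eq0 k j m q (A : 'M['Z_(p ^ k.+1)]_(m, q)) :
  (k < j)%N -> A *+ p ^ j = 0.
Proof.
move=> lt_kj; apply/matrixP=> r s; apply: val_inj; rewrite mulmxnE valZ_muln mxE.
by apply/eqP; rewrite -/(dvdn _ _) dvdn_mull ?dvdn_exp2l.
Qed.

(** An entry times p^j is divisible by p^(k+1), so k + 1 > j leaves a factor p in the entry. *)
Lemma mxZ_pX_torsion k j m q (A : 'M['Z_(p ^ k.+1)]_(m, q)) :
  (j <= k)%N -> A *+ p ^ j = 0 -> exists B, A = B *+ p.
Proof.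
move=> le_jk A0; exists (map_mx (fun a : 'Z_(p ^ k.+1) => inZp (a %/ p)) A).
apply/matrixP=> i l; apply: val_inj; rewrite mulmxnE valZ_muln [in RHS]mxE val_inZp.
have /(congr1 (fun M : 'M_(m, q) => val (M i l)))/eqP := A0.
rewrite mulmxnE valZ_muln mxE -/(dvdn _ _) => pkA.
have pA : (p %| A i l)%N.
  rewrite -(@dvdn_pmul2r (p ^ j)) ?expn_gt0 ?prime_gt0 // -expnS.
  by apply: dvdn_trans pkA; rewrite dvdn_exp2l.
by rewrite modnMml divnK // modn_small.
Qed.

(** The entrywise formula of [Zpk_red] for any shape, hence also for affine matrices; [j] may exceed
    [k]. *)
Definition mx_red k j m q (A : 'M['Z_(p ^ k.+1)]_(m, q)) : 'M['Z_(p ^ j.+1)]_(m, q) :=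
  map_mx (fun a : 'Z_(p ^ k.+1) => (a%:R : 'Z_(p ^ j.+1))) A.

Lemma val_mx_red k j m q (A : 'M['Z_(p ^ k.+1)]_(m, q)) i l :
  mx_red j A i l = (A i l %% p ^ j.+1)%N :> nat.
Proof. by rewrite mxE; apply: val_Zp_nat. Qed.

Lemma mx_red_trans k j i m q (A : 'M['Z_(p ^ k.+1)]_(m, q)) :
  (i <= j)%N -> mx_red i (mx_red j A) = mx_red i A.
Proof.
move=> le_ij; apply/matrixP=> r s; apply: ord_inj.
by rewrite !val_mx_red modn_dvdm ?dvdn_exp2l.
Qed.

Lemma mx_red_id k m q (A : 'M['Z_(p ^ k.+1)]_(m, q)) : mx_red k A = A.
Proof.
by apply/matrixP=> r s; apply: ord_inj; rewrite val_mx_red modn_small.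
Qed.

Lemma mx_red_scalar_1 k j m : mx_red j (1%:M : 'M['Z_(p ^ k.+1)]_m) = 1%:M.
Proof.
by apply/matrixP=> r s; rewrite !mxE; case: eqP => _; rewrite /= ?modn_small.
Qed.

Lemma mx_red0 k j m q : mx_red j (0 : 'M['Z_(p ^ k.+1)]_(m, q)) = 0.
Proof. by apply/matrixP=> r s; rewrite !mxE. Qed.

Lemma mx_red_eqP k j m q (A B : 'M['Z_(p ^ k.+1)]_(m, q)) : (j <= k)%N ->
  mx_red j A = mx_red j B <-> exists C, A = B + C *+ p ^ j.+1.
Proof.
move=> le_jk; have dv : (p ^ j.+1 %| p ^ k.+1)%N by rewrite dvdn_exp2l.
split=> [eqAB | [C ->]]; last first.
  apply/matrixP=> r s; apply: ord_inj; rewrite !val_mx_red mxE valZ_add mulmxnE.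
  by rewrite valZ_muln modnDmr modn_dvdm // addnC modnMDl.
exists (map_mx (fun a : 'Z_(p ^ k.+1) => inZp (a %/ p ^ j.+1)) (A - B)).
rewrite -[LHS](subrKC B); congr (_ + _).
apply/matrixP=> r s; apply: val_inj.
rewrite mulmxnE valZ_muln [in RHS]mxE val_inZp modnMml divnK ?modn_small //.
have eqrs : mx_red j A r s = mx_red j B r s :> nat by rewrite eqAB.
rewrite !val_mx_red in eqrs; rewrite !mxE valZ_add valZ_opp.
(* Modulo p^(j+1) the entry of A may be replaced by that of B, which turns the difference into
   p^(k+1). *)
rewrite /dvdn modn_dvdm // -modnDmr modn_dvdm // modnDmr -modnDml eqrs modnDml.
by rewrite subnKC ?modn_dvdm ?(eqP dv) // ltnW.
Qed.

End PrimePowerMatrices.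

(** * Affine matrices of elements of the holomorph *)

Section AffineMatrix.

Variables (p n : nat).
Local Notation K k := (Zpk p n k).

Definition aut_mx k (f : {perm K k}) : 'M['Z_(p ^ k.+1)]_n :=
  \matrix_i (f (delta_mx 0 i) : 'rV['Z_(p ^ k.+1)]_n).

(** Every scalar of ['Z_(p ^ k.+1)] is a natural multiple of 1, so an additive map is already
    linear. *)
Lemma aut_mxE k (f : {perm K k}) (z : K k) :
  f \in Aut [set: K k] -> f z = z *m aut_mx f.
Proof.
move=> Af; pose g (x : 'rV['Z_(p ^ k.+1)]_n) : 'rV['Z_(p ^ k.+1)]_n := f x.
have gD x y : g (x + y) = g x + g y by apply: (Aut_setT_morph Af).
have g0 : g 0 = 0 by apply: (addrI (g 0)); rewrite -gD !addr0.
have gMn x m : g (x *+ m) = g x *+ m.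
  by elim: m => // m IHm; rewrite !mulrS gD IHm.
rewrite -[f z]/(g z) [in LHS](row_sum_delta z) mulmx_sum_row.
rewrite (big_morph g gD g0); apply: eq_bigr => i _.
by rewrite rowK -[z 0 i]natr_Zp !scaler_nat gMn.
Qed.

(* Since f (z + x) = f z + f x, the translation part is f x rather than x. *)
Definition aff_mx k (u : hol (K k)) : 'M['Z_(p ^ k.+1)]_(1 + n) :=
  block_mx 1%:M (u.1 u.2) 0 (aut_mx u.1).

Lemma aff_mx_inj k : injective (@aff_mx k).
Proof.
move=> u v /eq_block_mx[_ eq2 _ eq1]; apply: val_inj.
have eqf : u.1 = v.1 by apply/permP=> z; rewrite !aut_mxE ?hol_Aut // eq1.
rewrite /= [LHS]surjective_pairing [RHS]surjective_pairing -eqf; congr (_, _).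
by apply: (@perm_inj _ u.1); rewrite eq2 eqf.
Qed.

(** The order is reversed because [v] acts first in the product, and on row vectors the matrix
    acting first stands on the left. *)
Lemma aff_mxM k (u v : hol (K k)) : aff_mx (u * v)%g = aff_mx v *m aff_mx u.
Proof.
rewrite mulmx_block !mul0mx !mulmx0 !mul1mx !add0r addr0; congr block_mx.
  rewrite /= permM (Aut_setT_morph (hol_Aut v)) permKV.
  by rewrite (Aut_setT_morph (hol_Aut u)) -aut_mxE ?hol_Aut.
apply/row_matrixP=> i; rewrite row_mul rowK /= permM.
by rewrite rowK -aut_mxE ?hol_Aut.
Qed.

Lemma aff_mx1 k : aff_mx (1%g : hol (K k)) = 1%:M.
Proof.
rewrite [RHS]scalar_mx_block; congr block_mx; first by rewrite /= perm1.
by apply/row_matrixP=> i; rewrite rowK perm1 row1.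
Qed.

Lemma aff_mxX k (u : hol (K k)) m : aff_mx (u ^+ m)%g = aff_mx u ^+ m.
Proof.
elim: m => [|m IHm]; first exact: aff_mx1.
by rewrite expgS aff_mxM IHm exprSr.
Qed.

Lemma aff_mx_col0 k (u v : hol (K k)) : lsubmx (aff_mx u) = lsubmx (aff_mx v).
Proof. by rewrite /aff_mx !block_mxEh !row_mxKl. Qed.

Hypothesis p_pr : prime p.

Lemma aff_mx_red k j (le_jk : (j <= k)%N) (u : hol (K k)) :
  aff_mx (hol_red p n le_jk u) = mx_red j (aff_mx u).
Proof.
have redE z : mx_red j z = Zpk_red j z by [].
rewrite /mx_red map_block_mx -!/(mx_red _ _) mx_red0 mx_red_scalar_1 //.
have indE := induced_autE (@Zpk_redM p n k j le_jk) (Zpk_red_surj le_jk)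
  (Zpk_red_char le_jk).
congr block_mx; first by rewrite /= indE ?hol_Aut.
apply/row_matrixP=> i; rewrite rowK.
(* [induced_autE] computes the induced automorphism on reductions only, so the basis vector is
   written as one. *)
have -> : delta_mx 0 i = Zpk_red j (delta_mx 0 i : K k).
  rewrite -redE; apply/matrixP=> r s; rewrite !mxE.
  by case: (_ && _); rewrite /= ?modn_small.
by rewrite /= indE ?hol_Aut // -redE; apply/rowP=> s; rewrite !mxE.
Qed.

Lemma hol_red_trans k j i (le_ij : (i <= j)%N) (le_jk : (j <= k)%N)
    (le_ik : (i <= k)%N) (u : hol (K k)) :
  hol_red p n le_ij (hol_red p n le_jk u) = hol_red p n le_ik u.
Proof. by apply: aff_mx_inj; rewrite !aff_mx_red mx_red_trans. Qed.

Lemma hol_red_eq1P k j (le_jk : (j <= k)%N) (u : hol (K k)) :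
  hol_red p n le_jk u = 1%g <-> exists B, aff_mx u = 1%:M + B *+ p ^ j.+1.
Proof.
rewrite -mx_red_eqP // mx_red_scalar_1 // -aff_mx_red.
by split=> [-> | eq1]; [apply: aff_mx1 | apply: aff_mx_inj; rewrite aff_mx1].
Qed.


Lemma GammaHolP k (u : hol (K k)) :
  reflect (exists B, aff_mx u = 1%:M + B *+ p) (u \in GammaHol p n k).
Proof.
have := hol_red_eq1P (leq0n k) u; rewrite expn1 => red1P.
by apply: (iffP (kerP _ (in_setT u))) => /red1P.
Qed.

Lemma mxZ_1D_pX_exp k m (B : 'M['Z_(p ^ k.+1)]_m) : odd p ->
  (1%:M + B *+ p) ^+ (p ^ k) = 1%:M.
Proof.
move=> p_odd; have [C eqC] := expr_prime_iter_1D p_pr p_odd k B.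
by rewrite [LHS]eqC mxZ_pX_eq0 // addr0.
Qed.

(** The lower right block F is 1 modulo p, so F^(p^k) = 1 and F^(p^k - 1) inverts F; z |-> z F is
    the automorphism sought. *)
Lemma aff_mx_surj k (M B : 'M['Z_(p ^ k.+1)]_(1 + n)) : odd p ->
  lsubmx M = lsubmx 1%:M -> M = 1%:M + B *+ p -> exists u : hol (K k), aff_mx u = M.
Proof.
move=> p_odd M_col0 eqM; pose F := drsubmx M.
have F_exp : F ^+ (p ^ k) = 1%:M.
  suff ->: F = 1%:M + drsubmx B *+ p by apply: mxZ_1D_pX_exp.
  rewrite /F eqM /drsubmx !(raddfD, raddfMn) /=; congr (_ + _).
  by rewrite scalar_mx_block col_mxKd row_mxKr.
have F_inv : F *m F ^+ (p ^ k).-1 = 1%:M.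
  by rewrite -[LHS]exprS prednK ?expn_gt0 ?prime_gt0.
have F_inv' : F ^+ (p ^ k).-1 *m F = 1%:M.
  by rewrite -[LHS]exprSr prednK ?expn_gt0 ?prime_gt0.
pose f (z : K k) : K k := z *m F.
have fK : cancel f (fun z : K k => z *m F ^+ (p ^ k).-1).
  by move=> z; rewrite /f -mulmxA F_inv mulmx1.
have Af : perm (can_inj fK) \in Aut [set: K k].
  rewrite inE; apply/andP; split; first by apply/subsetP=> z; rewrite inE.
  by apply/morphicP=> y z _ _; rewrite !permE; apply: mulmxDl.
(* The upper right block is the image of x under F, so x is recovered by the inverse of F. *)
pose x : K k := ursubmx M *m F ^+ (p ^ k).-1.
have Ax : (perm (can_inj fK), x).1 \in Aut [set: K k] by [].
exists (Hol Ax); rewrite -[RHS]hsubmxK M_col0 scalar_mx_block /aff_mx /= !block_mxEh.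
rewrite row_mxKl; congr (row_mx _ _); rewrite -[RHS]vsubmxK; congr (col_mx _ _).
  by rewrite permE /f -mulmxA F_inv' mulmx1; apply/matrixP=> i j; rewrite !mxE.
apply/row_matrixP=> i; rewrite rowK permE /f -rowE.
by apply/rowP=> j; rewrite !mxE.
Qed.

End AffineMatrix.

(** * The subgroups Omega_1 and their centrality *)

Section CongruenceTower.

Variables (p n : nat) (p_pr : prime p) (p_odd : odd p).
Local Notation K k := (Zpk p n k).
Local Notation Gamma k := (GammaHol p n k).
Local Notation red_ker k := ('ker (hol_red p n (leqnSn k)))%g.

Lemma red_kerP k (u : hol (K k.+1)) :
  reflect (exists B, aff_mx u = 1%:M + B *+ p ^ k.+1) (u \in red_ker k).
Proof.
have red1P := hol_red_eq1P p_pr (leqnSn k) u.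
by apply: (iffP (kerP _ (in_setT u))) => /red1P.
Qed.

Lemma red_ker_sub k : red_ker k \subset Gamma k.+1.
Proof.
apply/subsetP=> u /red_kerP[B eqB]; apply/GammaHolP=> //.
by exists (B *+ p ^ k); rewrite -mulrnA -expnSr.
Qed.

Lemma GammaHol_pgroup k : p.-group%g (Gamma k).
Proof.
apply/pgroupP=> q q_pr /(Cauchy q_pr)[u /(GammaHolP p_pr)[B eqB] ord_u].
suff : (q %| p ^ k)%N by rewrite Euclid_dvdX // => /andP[]; rewrite dvdn_prime2.
rewrite -ord_u order_dvdn; apply/eqP/aff_mx_inj.
by rewrite aff_mxX aff_mx1 eqB mxZ_1D_pX_exp.
Qed.

Lemma GammaHol_expp_eq1 k (u : hol (K k.+1)) :
  u \in Gamma k.+1 -> (u ^+ p = 1)%g <-> u \in red_ker k.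
Proof.
move=> /(GammaHolP p_pr)[B0 eqB0]; split=> [up1 | /red_kerP[B eqB]]; last first.
  apply: aff_mx_inj; rewrite aff_mxX aff_mx1 eqB.
  have [C ->] := expr_prime_1D p_pr p_odd B (ltn0Sn k).
  by rewrite mxZ_pX_eq0 ?addr0.
have aff1 : aff_mx u ^+ p = 1%:M by rewrite -aff_mxX up1 aff_mx1.
(* If u = 1 + p^(j+1) B with j < k, then u^p = 1 gives p^(j+2) (B + p C) = 0, so p divides B and u
   is 1 modulo p^(j+2). *)
suff step j : (j <= k)%N -> exists B, aff_mx u = 1%:M + B *+ p ^ j.+1.
  by apply/red_kerP; apply: step.
elim: j => [|j IHj] lt_jk; first by exists B0; rewrite expn1.
have [B eqB] := IHj (ltnW lt_jk).
have [C eqC] := expr_prime_1D p_pr p_odd B (ltn0Sn j).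
have : (B + C *+ p) *+ p ^ j.+2 = 0.
  by apply: (addrI 1); rewrite addr0 -eqC -[RHS]aff1 eqB.
case/mxZ_pX_torsion => // D eqD; exists (D - C).
have eqB' : B = (D - C) *+ p by rewrite mulrnBl -eqD addrK.
by rewrite eqB eqB' -mulrnA -expnS.
Qed.

(** The solutions of u^p = 1 already form a subgroup, so generating adds nothing. *)
Lemma Ohm1_GammaHol k : 'Ohm_1(Gamma k.+1)%g = red_ker k.
Proof.
rewrite (OhmE 1 (GammaHol_pgroup k.+1)) expn1 -[RHS]genGid; congr <<_>>%g.
apply/setP=> u; apply/LdivP/idP=> [[Gu /(GammaHol_expp_eq1 Gu)] // | Ku].
by have Gu := subsetP (red_ker_sub k) u Ku; split; last exact/GammaHol_expp_eq1.
Qed.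

Lemma GammaHol_p_central k : p_central p (Gamma k.+1).
Proof.
rewrite /p_central GammaHol_pgroup Ohm1_GammaHol.
apply/subsetP=> u Ku; apply/centerP; split; first exact: subsetP (red_ker_sub k) u Ku.
move=> v /(GammaHolP p_pr)[C eqC]; have /red_kerP[B eqB] := Ku.
apply: aff_mx_inj; rewrite !aff_mxM eqB eqC.
have mx0 (X Y : 'M['Z_(p ^ k.+2)]_(1 + n)) : (X *+ p) *m (Y *+ p ^ k.+1) = 0.
  by rewrite [LHS]mulrnAl [X * _]mulrnAr -mulrnA -expnSr mxZ_pX_eq0.
have mx0' (X Y : 'M['Z_(p ^ k.+2)]_(1 + n)) : (Y *+ p ^ k.+1) *m (X *+ p) = 0.
  by rewrite [LHS]mulrnAl [Y * _]mulrnAr -mulrnA -expnS mxZ_pX_eq0.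
by rewrite !mulmxDl !mulmxDr mx0 mx0' !mulmx1 !mul1mx !addr0 addrAC.
Qed.

(** * Kernel and image of the reduction between consecutive levels *)

Lemma ker_piHol k : ('ker (piHol p n k))%g = red_ker k.
Proof. by rewrite ker_restrm; apply/setIidPr/red_ker_sub. Qed.

Lemma piHol_im k : (piHol p n k @* Gamma k.+1)%g = Gamma k.
Proof.
rewrite morphim_restrm setIid; apply/setP=> v; apply/morphimP/idP.
  case=> u _ /(kerP _ (in_setT u)) u1 ->.
  apply/(kerP _ (in_setT _)).
  by rewrite (hol_red_trans p_pr (leq0n k) (leqnSn k) (leq0n k.+1)).
move=> Gv; have red_v := kerP _ (in_setT v) Gv.
(* Here [mx_red] goes to the larger modulus: it lifts each entry to its least representative, and
   reducing back recovers [aff_mx v]. *)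
pose M := mx_red k.+1 (aff_mx v).
have redM : mx_red k M = aff_mx v by rewrite mx_red_trans // mx_red_id.
have red0M : mx_red 0 M = mx_red 0 (1%:M : 'M['Z_(p ^ k.+2)]_(1 + n)).
  by rewrite mx_red_trans // -aff_mx_red // red_v aff_mx1 mx_red_scalar_1.
have [B] := proj1 (mx_red_eqP p_pr _ _ (leq0n k.+1)) red0M.
rewrite expn1 => eqB.
have [|u eqM] := aff_mx_surj p_pr p_odd _ eqB.
  rewrite -(mx_red_scalar_1 p k) -aff_mx1 /M /mx_red -!map_lsubmx.
  by rewrite (aff_mx_col0 v 1%g).
exists u; rewrite ?in_setT //; first by apply/GammaHolP=> //; exists B; rewrite eqM.
by apply: aff_mx_inj; rewrite aff_mx_red // eqM redM.
Qed.

(** * The p-power map *)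

Lemma aff_mx_expp k (y : hol (K k.+2)) B :
  aff_mx y = 1%:M + B *+ p ^ k.+1 -> aff_mx (y ^+ p)%g = 1%:M + B *+ p ^ k.+2.
Proof.
move=> eqB; rewrite aff_mxX eqB.
have [C ->] := expr_prime_1D p_pr p_odd B (ltn0Sn k).
by rewrite mulrnDl -mulrnA -expnS [C *+ _]mxZ_pX_eq0 ?addr0.
Qed.

(** Such a y lies in the pulled back extension, so it can replace the chosen preimage in the p-power
    map. *)
Lemma ppower_map_GammaHol k (y : hol (K k.+2)) B :
  aff_mx y = 1%:M + B *+ p ^ k.+1 ->
  [/\ y \in Gamma k.+2, piHol p n k.+1 y \in 'Ohm_1(Gamma k.+1)%g
    & ppower_map p (Gamma k.+1) (piHol p n k.+1) (piHol p n k.+1 y) = (y ^+ p)%g].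
Proof.
move=> eqB.
have Gy : y \in Gamma k.+2.
  by apply/GammaHolP=> //; exists (B *+ p ^ k); rewrite -mulrnA -expnSr.
have Oy : piHol p n k.+1 y \in 'Ohm_1(Gamma k.+1)%g.
  rewrite Ohm1_GammaHol; apply/(kerP _ (in_setT _)).
  rewrite (hol_red_trans p_pr (leqnSn k) (leqnSn k.+1) (leqW (leqnSn k))).
  by apply/(hol_red_eq1P p_pr); exists B.
split=> //; apply: ppower_mapE (GammaHol_p_central k.+1) _ _.
  by rewrite ker_piHol Ohm1_GammaHol.
exact/morphpreP.
Qed.

(** Any preimage y works: it reduces to 1 at level k, which is a congruence modulo p^(k+1). *)
Lemma Ohm1_GammaHol_lift k (x : hol (K k.+1)) : x \in 'Ohm_1(Gamma k.+1)%g ->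
  exists y : hol (K k.+2), exists2 B,
    aff_mx y = 1%:M + B *+ p ^ k.+1 & x = piHol p n k.+1 y.
Proof.
move=> Ox; have : x \in Gamma k.+1 by apply: subsetP Ox; apply: Ohm_sub.
rewrite -piHol_im => /morphimP[y _ _ eq_x]; exists y.
have : x \in red_ker k by rewrite -Ohm1_GammaHol.
rewrite eq_x => /(kerP _ (in_setT _)).
rewrite (hol_red_trans p_pr (leqnSn k) (leqnSn k.+1) (leqW (leqnSn k))).
by case/hol_red_eq1P=> // B eqB; exists B.
Qed.

Lemma ppower_map_misom k : misom 'Ohm_1(Gamma k.+1) 'Ohm_1(Gamma k.+2)
  (ppower_map p (Gamma k.+1) (piHol p n k.+1)).
Proof.
set phi := ppower_map _ _ _.
have phiM : morphic 'Ohm_1(Gamma k.+1) phi.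
  apply/morphicP=> x1 x2 /Ohm1_GammaHol_lift[y [B eqB ->]].
  case/Ohm1_GammaHol_lift=> z [C eqC ->].
  have [Gy _ phiy] := ppower_map_GammaHol eqB.
  have [Gz _ phiz] := ppower_map_GammaHol eqC.
  have eqBC : aff_mx (y * z)%g = 1%:M + (B + C + C *m B *+ p ^ k.+1) *+ p ^ k.+1.
    rewrite aff_mxM eqB eqC mulmxDl !mulmxDr !mulmx1 mul1mx.
    have -> : (C *+ p ^ k.+1) *m (B *+ p ^ k.+1) = C *m B *+ p ^ k.+1 *+ p ^ k.+1.
      by rewrite [LHS]mulrnAl mulrnAr.
    by rewrite !mulrnDl !addrA.
  have [_ _ phiyz] := ppower_map_GammaHol eqBC.
  rewrite -morphM // /phi phiyz phiy phiz; apply: aff_mx_inj.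
  rewrite aff_mxM !(aff_mx_expp eqB, aff_mx_expp eqC, aff_mx_expp eqBC).
  (* The quadratic term carries p^(2k+3), which is 0 modulo p^(k+3). *)
  have -> : (B + C + C *m B *+ p ^ k.+1) *+ p ^ k.+2 = B *+ p ^ k.+2 + C *+ p ^ k.+2.
    by rewrite !mulrnDl -mulrnA -expnD [C *m B *+ _]mxZ_pX_eq0 ?addr0 // addSnnS leq_addl.
  rewrite mulmxDl !mulmxDr !mulmx1 mul1mx.
  have -> : (C *+ p ^ k.+2) *m (B *+ p ^ k.+2) = 0.
    by rewrite [LHS]mulrnAl [C * _]mulrnAr -mulrnA -expnD mxZ_pX_eq0 // addSnnS leq_addl.
  by rewrite addr0 addrA.
apply/misomP; exists phiM; apply/isomP; split.
  apply/subsetP=> x /morphpreP[Ox]; have [y [B eqB eq_x]] := Ohm1_GammaHol_lift Ox.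
  have [Gy _ phiy] := ppower_map_GammaHol eqB.
  (* Injectivity: y^p = 1 puts y in the kernel of the reduction, so its image x is 1. *)
  rewrite eq_x => /set1P/(etrans (esym phiy))/GammaHol_expp_eq1-/(_ Gy).
  move=> /(kerP _ (in_setT _)) y1.
  by apply/set1P.
rewrite [RHS]Ohm1_GammaHol; apply/setP=> w; apply/morphimP/idP.
  case=> x _ /Ohm1_GammaHol_lift[y [B eqB ->]] eq_w.
  have [_ _ phiy] := ppower_map_GammaHol eqB; rewrite (etrans eq_w phiy).
  by apply/red_kerP; exists B; apply: aff_mx_expp.
case/red_kerP=> B eqB.
(* The first column of B may be nonzero, as only B *+ p ^ k.+2 is determined by w. *)
pose B' : 'M_(1 + n) := row_mx 0 (rsubmx B).
have eqB' : B' *+ p ^ k.+2 = B *+ p ^ k.+2.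
  (* The first columns of [aff_mx w] and of 1 agree, so p^(k+2) B has first column 0. *)
  rewrite -[RHS]hsubmxK (_ : lsubmx _ = 0); last first.
    apply: (addrI (lsubmx 1%:M)); rewrite addr0 -raddfD -eqB -aff_mx1.
    exact: aff_mx_col0.
  rewrite raddfMn; apply/matrixP=> i j; rewrite !(mulmxnE, mxE).
  by case: splitP => ?; rewrite !(mulmxnE, mxE) ?mul0rn.
(* Surjectivity: 1 + p^(k+1) B' is the matrix of an element y with y^p = w. *)
have [] := @aff_mx_surj p n p_pr k.+2 (1%:M + B' *+ p ^ k.+1) (B' *+ p ^ k) p_odd.
- by rewrite raddfD raddfMn /= row_mxKl mul0rn addr0.
- by rewrite -mulrnA -expnSr.
move=> y eqy; have [Gy Oy phiy] := ppower_map_GammaHol eqy.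
exists (piHol p n k.+1 y) => //; rewrite [RHS]phiy.
by apply: aff_mx_inj; rewrite eqB -eqB' (aff_mx_expp eqy).
Qed.

End CongruenceTower.

Theorem theorem4p3p3 (p : nat) (p_pr : prime p) (p_odd : odd p) (n : nat) :
  uniform_tower p (fun k => GammaHol p n k.+1) (fun k => piHol p n k.+1).
Proof.
split; last by move=> k; apply: ppower_map_misom.
split=> k; first exact: GammaHol_p_central.
by rewrite piHol_im // ker_piHol // Ohm1_GammaHol.
Qed.
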